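(* Let $f\colon\mathbb Z\to\mathbb Z$ be LIP on $\mathbb Z$ and suppose that for all but finitely many $x\in\mathbb Z$ (with $x\neq 0$) $$|f(x)|<\frac{(2|x|-1)!}{2^{2|x|-1}}.$$ Then there is $p\in\mathbb Z[x]$ with $f(x)=p(x)$ for all $x\in\mathbb Z$.
   Context: A function $f\colon\mathbb Z\to\mathbb Z$ is LIP on $\mathbb Z$ if for every finite $X\subseteq\mathbb Z$ there is $p\in\mathbb Z[x]$ with $p(x)=f(x)$ for all $x\in X$. *)

(* Defs.v *)
From mathcomp Require Import all_boot all_order all_algebra.

Set Implicit Arguments.
Unset Strict Implicit.
Unset Printing Implicit Defensive.

Import Order.TTheory GRing.Theory Num.Theory.
Local Open Scope ring_scope.

(* Locally an integer polynomial; finite subsets X of Z are given by lists. *)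
Definition LIP (f : int -> int) : Prop :=
  forall X : seq int, exists p : {poly int}, forall x, x \in X -> p.[x] = f x.

(* Main.v *)
(* On m+1 consecutive integers starting at s, the alternating binomial sum of
   an integer polynomial (its m-th difference up to sign) is divisible by m!, so
   the same holds for f.  For m = 2n-1 and points in [-n, n], the growth bound
   makes |f| < m!/2^m for large n, and the binomial coefficients add up to 2^m, so
   this sum is smaller than m! in absolute value and hence vanishes.  Thus f
   coincides with the polynomial of degree at most 2N that interpolates it on
   [-N, N]: the agreement spreads one point at a time in both directions. *)
Require Import Defs.
From mathcomp Require Import all_boot all_order all_algebra.
From mathcomp Require Import zify.

Import Order.TTheory GRing.Theory Num.Theory.
Local Open Scope ring_scope.

Definition altsum (m : nat) (s : int) (g : int -> int) : int :=
  \sum_(i < m.+1) (-1) ^+ i * 'C(m, i)%:R * g (s + i%:Z).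

Lemma eq_altsum m (s : int) (g h : int -> int) :
    (forall i, (i <= m)%N -> g (s + i%:Z) = h (s + i%:Z)) ->
  altsum m s g = altsum m s h.
Proof. by move=> gh; apply: eq_bigr => i _; rewrite gh // -ltnS. Qed.

Lemma altsumD m s g h :
  altsum m s (fun x => g x + h x) = altsum m s g + altsum m s h.
Proof. by rewrite -big_split; apply: eq_bigr => i _; rewrite mulrDr. Qed.

Lemma altsumN m s g : altsum m s (fun x => - g x) = - altsum m s g.
Proof. by rewrite -sumrN; apply: eq_bigr => i _; rewrite mulrN. Qed.

Lemma altsum_const m s (c : int) : altsum m.+1 s (fun=> c) = 0.
Proof.
rewrite /altsum -big_distrl /=.
have -> : \sum_(i < m.+2) (-1) ^+ i * 'C(m.+1, i)%:R = (1 - 1) ^+ m.+1 :> int.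
  rewrite exprBn; apply: eq_bigr => i _.
  by rewrite !expr1n !mulr1 mulr_natr.
by rewrite subrr expr0n mul0r.
Qed.

(** The term at [s] is killed by the factor [x - s]; in the others
    [i * 'C(m.+1, i) = m.+1 * 'C(m, i.-1)], and the shift of the index costs a sign. *)
Lemma altsum_mulX m s g :
  altsum m.+1 s (fun x => g x * (x - s)) = - (m.+1%:R * altsum m (s + 1) g).
Proof.
rewrite /altsum big_ord_recl /= addr0 subrr !mulr0 add0r big_distrr -sumrN /=.
apply: eq_bigr => i _; rewrite /bump /= !add1n exprS.
rewrite [s + i.+1%:Z - s]addrC addKr -addrA -PoszD add1n.
have -> : (i.+1%:Z : int) = i.+1%:R by rewrite natz.
rewrite mulN1r !mulNr; congr (- _).
rewrite -!mulrA [RHS]mulrCA; congr (_ * _).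
by rewrite [g _ * _]mulrC !mulrA -!natrM mulnC -mul_bin_diag.
Qed.

(** Induction on [m]: write [p = q * ('X - s) + p.[s]]. The constant contributes nothing, and
    [altsum_mulX] extracts the factor [m.+1] and passes to [q], whose degree is one lower. *)
Lemma altsum_poly (m : nat) (s : int) (p : {poly int}) :
  exists2 c, altsum m s (horner p) = c * (m`!)%:R &
             (size p <= m)%N -> c = 0.
Proof.
elim: m s p => [|m IHm] s p.
  exists p.[s]; first by rewrite /altsum big_ord1 /= !mul1r addr0 mulr1.
  by rewrite leqn0 size_poly_eq0 => /eqP ->; rewrite horner0.
have /factor_theorem[q Dq] : root (p - p.[s]%:P) s.
  by rewrite /root !hornerE subrr.
have {}Dq : p = q * ('X - s%:P) + p.[s]%:P by rewrite -Dq subrK.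
have [c Dc c0] := IHm (s + 1) q.
exists (- c).
  rewrite (@eq_altsum _ _ _ (fun x => q.[x] * (x - s) + p.[s])); last first.
    by move=> i _; rewrite {1}Dq !hornerE.
  rewrite altsumD altsum_const addr0 altsum_mulX Dc factS natrM mulNr.
  by rewrite mulrCA.
move=> szp; rewrite c0 ?oppr0 //.
have [->|q0] := eqVneq q 0; first by rewrite size_poly0.
rewrite -ltnS; apply: leq_trans szp.
have sq : size (q * ('X - s%:P)) = (size q).+1.
  by rewrite size_Mmonic ?monicXsubC // size_XsubC addn2.
rewrite Dq size_polyDl sq //.
by rewrite (leq_ltn_trans (size_polyC_leq1 _)) // ltnS lt0n size_poly_eq0.
Qed.

Lemma altsum_dvd f m s : LIP f -> exists c, altsum m s f = c * (m`!)%:R.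
Proof.
move=> /(_ [seq s + i%:Z | i <- iota 0 m.+1])[p fp].
have [c Dc _] := altsum_poly m s p; exists c; rewrite -Dc.
apply: eq_altsum => i lim; rewrite fp //; apply/mapP; exists i => //.
by rewrite mem_iota add0n ltnS.
Qed.

Lemma altsum_lt m (s : int) (g : int -> int) :
    (forall i, (i <= m)%N -> (2 ^ m * `|g (s + i%:Z)%R| < m`!)%N) ->
  `|altsum m s g| < (m`!)%:R.
Proof.
move=> ltg.
(* Over the integers, the strict bound on each term becomes a bound by [m! - 1], so strictness
   survives summation. *)
suff: (2 ^ m)%:R * `|altsum m s g| <= (2 ^ m)%:R * (m`!.-1)%:R.
  rewrite ler_pM2l ?ltr0n ?expn_gt0 // => /le_lt_trans; apply.
  by rewrite ltr_nat prednK ?fact_gt0.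
have D2m : (2 ^ m = \sum_(i < m.+1) 'C(m, i))%N.
  by rewrite -[2%N]/(1 + 1)%N expnDn; apply: eq_bigr => i _; rewrite !exp1n !muln1.
rewrite [in leRHS]D2m natr_sum big_distrl /=.
apply: le_trans (_ : _ <= (2 ^ m)%:R * \sum_(i < m.+1)
    `|(-1) ^+ i * 'C(m, i)%:R * g (s + i%:Z)|) _.
  by rewrite ler_wpM2l ?ler0n // ler_norm_sum.
rewrite big_distrr /=; apply: ler_sum => i _.
rewrite !normrM normrX normrN1 expr1n mul1r normr_nat mulrCA.
rewrite ler_wpM2l ?ler0n // -abszE -[`|_|%N%:Z]natz -natrM ler_nat.
by have := ltg i (ltn_ord i); case: (m`!).
Qed.

Lemma altsum_eq0 f m (s : int) : LIP f ->
    (forall i, (i <= m)%N -> (2 ^ m * `|f (s + i%:Z)%R| < m`!)%N) ->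
  altsum m s f = 0.
Proof.
move=> /(altsum_dvd _ m s)[c Dc] /altsum_lt; rewrite Dc.
have [->|c0] := eqVneq c 0; first by rewrite mul0r.
rewrite normrM normr_nat gtr_pMl ?ltr0n ?fact_gt0 //.
by rewrite ltNge -gtz0_ge1 normr_gt0 c0.
Qed.

(** Each step of the index doubles the left side and multiplies the right side by at least 2,
    because [j] is positive. *)
Lemma ltn_exp2_fact_mono c j m :
  (0 < j <= m)%N -> (2 ^ j * c < j`!)%N -> (2 ^ m * c < m`!)%N.
Proof.
case/andP=> j0 /subnK <- ltj; elim: (m - j)%N => // k IHk.
rewrite addSn expnS factS; nia.
Qed.

(** The offset 4 makes the base case [16 <= 24] true; a step multiplies the left side by at most 4
    and the right side by [k + 5]. *)
Lemma leq_exp2_fact k : (2 ^ (k + 4) * k.+1 <= (k + 4)`!)%N.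
Proof.
elim: k => // k IHk; rewrite addSn expnS factS.
set a := (2 ^ _)%N in IHk *; set b := (_ `!)%N in IHk *.
have: (2 * a * k.+2 <= 4 * (a * k.+1))%N by nia.
nia.
Qed.

Lemma bounded_on_seq (f : int -> int) (E : seq int) :
  exists C, forall x, x \in E -> (`|f x| <= C)%N.
Proof.
exists (\sum_(x <- E) `|f x|)%N => x xE.
by rewrite (big_rem x xE) leq_addr.
Qed.

Lemma eventually_small (f : int -> int) (E : seq int) :
    (forall x, x \notin E -> x != 0 ->
       (2 ^ (2 * `|x| - 1) * `|f x| < (2 * `|x| - 1)`!)%N) ->
  exists N, forall n x, (N <= n)%N -> (`|x| <= n.+1)%N ->
    (2 ^ (2 * n).+1 * `|f x| < (2 * n).+1`!)%N.
Proof.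
(* The point 0 joins the exceptional ones, since the growth bound says nothing there; on all of them
   a constant [C] is beaten once [n >= C + 4]. *)
move=> fE; have [C EC] := bounded_on_seq f (0 :: E).
exists (C + 4)%N => n x leCn lexn.
have [xE|] := boolP (x \in 0 :: E).
  apply: (@ltn_exp2_fact_mono _ (C + 4)); first by lia.
  apply: leq_trans (leq_exp2_fact C).
  by rewrite ltn_pmul2l ?expn_gt0 // ltnS EC.
rewrite inE negb_or => /andP[x0 /fE/(_ x0)].
(* The bound known at index [2|x| - 1] is carried up to [2n + 1], which is possible as
   [1 <= |x| <= n + 1]. *)
by apply: ltn_exp2_fact_mono; lia.
Qed.

(** LIP gives no control of the degree. Reducing modulo the monic polynomial [w] that vanishes on
    [X] keeps integer coefficients and the values on [X]. *)
Lemma LIP_interpolation f (X : seq int) : LIP f ->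
  exists2 p : {poly int}, (size p <= size X)%N & {in X, forall x, f x = p.[x]}.
Proof.
move=> /(_ X)[p fp]; pose w := \prod_(x <- X) ('X - x%:P).
have wmon : w \is monic by apply: monic_prod_XsubC.
exists (Pdiv.Ring.rmodp p w).
  by rewrite -ltnS -(size_prod_XsubC X id) Pdiv.Ring.ltn_rmodp monic_neq0.
move=> x xX; rewrite -fp // {1}(Pdiv.RingMonic.rdivp_eq wmon p) !hornerE.
by have /rootP-> : root w x; rewrite ?root_prod_XsubC // mulr0 add0r.
Qed.

Lemma altsum_first m (s : int) (g : int -> int) :
    (forall i, (0 < i <= m)%N -> g (s + i%:Z) = 0) ->
  altsum m s g = g s.
Proof.
move=> g0; rewrite /altsum big_ord_recl big1 => [|i _].
  by rewrite /= bin0 !mul1r !addr0.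
by rewrite g0 ?mulr0 //= /bump /= add1n ltn_ord.
Qed.

Lemma altsum_last m (s : int) (g : int -> int) :
    (forall i, (i < m)%N -> g (s + i%:Z) = 0) ->
  altsum m s g = (-1) ^+ m * g (s + m%:Z).
Proof.
move=> g0; rewrite /altsum big_ord_recr big1 => [|i _].
  by rewrite /= binn mulr1 add0r.
by rewrite g0 ?mulr0 /=.
Qed.

(** The two windows are [[-n, n+1]] and [[-n-1, n]]. When [g] vanishes on [[-n, n]], each sum
    reduces to its one new endpoint, with coefficient 1 or -1. *)
Lemma vanish_of_altsum (g : int -> int) N :
    (forall x : int, (`|x| <= N)%N -> g x = 0) ->
    (forall n, (N <= n)%N -> altsum (2 * n).+1 (- n%:Z) g = 0 /\
                             altsum (2 * n).+1 (- n.+1%:Z) g = 0) ->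
  forall x, g x = 0.
Proof.
move=> gN gS x.
suff gn k y : (`|y| <= N + k)%N -> g y = 0 by apply: (gn `|x|%N); lia.
elim: k y => [|k IHk] y ley; first by rewrite gN -1?[N]addn0.
have [/IHk //|lty] := leqP `|y|%N (N + k).
have [gr gl] := gS (N + k)%N (leq_addr _ _).
have [y0|y0] := leP 0 y.
- have Dy : y = - (N + k)%N%:Z + (2 * (N + k)).+1%:Z by lia.
  move/eqP: gr; rewrite altsum_last => [|i lti]; last by apply: IHk; lia.
  by rewrite -Dy mulf_eq0 signr_eq0 => /eqP.
have Dy : y = - (N + k).+1%:Z by lia.
by rewrite Dy -[LHS](@altsum_first (2 * (N + k)).+1) // => i lti; apply: IHk; lia.
Qed.

Theorem theorem7 (f : int -> int)
  (f_LIP : LIP f)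
  (f_bound : exists E : seq int, forall x : int, x \notin E -> x != 0 ->
     (`|f x|%:~R : rat) <
       ((2 * `|x|%N - 1)%N`!)%:R / 2%:R ^+ (2 * `|x|%N - 1)%N) :
  exists p : {poly int}, forall x : int, f x = p.[x].
Proof.
have [E fE] := f_bound.
have [N smallf] : exists N, forall n x, (N <= n)%N -> (`|x| <= n.+1)%N ->
    (2 ^ (2 * n).+1 * `|f x| < (2 * n).+1`!)%N.
  apply: (@eventually_small f E) => x xE x0; have := fE x xE x0.
  rewrite ltr_pdivlMr ?exprn_gt0 ?ltr0n // -natrX -abszE -pmulrn -natrM ltr_nat.
  by rewrite mulnC.
pose X := [seq - N%:Z + i%:Z | i <- iota 0 (2 * N).+1].
have [p szp fp] := LIP_interpolation _ X f_LIP.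
rewrite size_map size_iota in szp.
exists p => x; apply/eqP; rewrite -subr_eq0; apply/eqP.
apply: (vanish_of_altsum (fun y => f y - p.[y]) N) => [y ley|n leNn].
  rewrite fp ?subrr //; apply/mapP; exists `|(y + N%:Z)%R|%N; last by lia.
  by rewrite mem_iota; lia.
(* Interpolation at the [2N + 1] points of [[-N, N]] gives [size p <= 2N + 1 <= 2n + 1], so
   differences of order [2n + 1] annihilate [p]. *)
have altp s : altsum (2 * n).+1 s (horner p) = 0.
  have [c -> ->] := altsum_poly (2 * n).+1 s p; first exact: mul0r.
  by lia.
by split; rewrite altsumD altsumN altp oppr0 addr0; apply: altsum_eq0 => // i lei;
  apply: smallf => //; lia.
Qed.
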